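(* Let $A$ and $B$ be unital function algebras, with $B$ selfadjoint, and let $T : A \to B$ be a linear contraction. Suppose that $T$ satisfies the following condition: there is a partial isometry $u \in B^{**}$ with initial projection $e \in B^{**}$ (that is, $u^*u = e$), where $e$ may be taken to be a closed projection, and a (completely isometric) one-to-one $*$-homomorphism $\pi : C^*_e(A) \to e B^{**} e$ with $\pi(1) = e$, such that for all $a \in A$ $$\widehat{T(a)}\, e = u\, \pi(a) \quad \text{and} \quad \pi(a) = u^*\, \widehat{T(a)} .$$ Then there exist a closed ideal $I$ of $B$, a unitary $v$ in the quotient $C^*$-algebra $B/I$, and a unital one-to-one $*$-homomorphism $\rho : A \to B/I$, such that $q_I(T(a)) = v\, \rho(a)$ for all $a \in A$, where $q_I : B \to B/I$ is the canonical quotient $*$-homomorphism.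
   Context: A unital function algebra is a closed subalgebra of some $C(K)$ ($K$ compact Hausdorff) containing the constant functions; $B$ selfadjoint means that $B$ is closed under complex conjugation, so $B$ is a commutative unital $C^*$-algebra. Any linear contraction between subspaces of $C(K)$-spaces is automatically completely contractive, i.e. all its matrix amplifications $[x_{ij}] \mapsto [T(x_{ij})]$ are contractive; a map is completely isometric if all these amplifications are isometric. For $A$ not selfadjoint, ''one-to-one $*$-homomorphism $\rho: A \to B/I$'' means the restriction to $A$ of a one-to-one $*$-homomorphism on the $C^*$-algebra $C^*_e(A)$ containing $A$. $C^*$-envelope: $C^*_e(A)$ denotes the (essentially unique) pair $(C, j)$ consisting of a unital $C^*$-algebra $C$ and a complete isometry $j : A \to C$ with $j(1)=1_C$, whose range generates $C$ as a $C^*$-algebra, with the following universal property: for any unital $C^*$-algebra $D$ and any complete isometry $i : A \to D$ with $i(1) = 1_D$ whose range generates $D$ as a $C^*$-algebra, there is a (necessarily unique, unital and surjective) $*$-homomorphism $\theta : D \to C$ with $\theta \circ i = j$. Such a pair exists, and $j$ is a homomorphism; $A$ is regarded as a unital subalgebra of $C^*_e(A)$ via $j$. $B^{**}$ is the second dual of $B$, a von Neumann algebra (commutative here), and $b \mapsto \hat{b}$ is the canonical embedding $B \to B^{**}$. A projection $e \in B^{**}$ is closed if $1-e$ is the weak* limit in $B^{**}$ of an increasing net of positive elements of $B$. *)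

(* Defs.v *)
From HB Require Import structures.
From mathcomp Require Import all_boot all_order all_algebra.
From mathcomp Require Import complex.
From mathcomp Require Import mathcomp_extra boolp classical_sets functions.
From mathcomp Require Import reals topology normedtype derive.
From mathcomp Require Import ring lra.

Set Implicit Arguments.
Unset Strict Implicit.
Unset Printing Implicit Defensive.

Import Order.TTheory GRing.Theory Num.Theory.
Import numFieldNormedType.Exports.
Local Open Scope classical_set_scope.
Local Open Scope ring_scope.
Local Open Scope complex_scope.
Local Open Scope quotient_scope.

(* Unital complex algebras, written with their own product: the joins of
   GRing.PzRing with GRing.Lmodule and with NormedModule cannot be declared
   on top of the library hierarchy. The zero algebra is allowed. *)
HB.mixin Record isUnitalAlg (R : realType) A of GRing.Lmodule R[i] A := {
  amul : A -> A -> A;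
  aone : A;
  amulA : associative amul;
  amul1x : left_id aone amul;
  amulx1 : right_id aone amul;
  amulDl : left_distributive amul +%R;
  amulDr : right_distributive amul +%R;
  amulZl : forall (a : R[i]) (x y : A), amul (a *: x) y = a *: amul x y;
  amulZr : forall (a : R[i]) (x y : A), amul x (a *: y) = a *: amul x y
}.

#[short(type="unitalAlgType")]
HB.structure Definition UnitalAlg (R : realType) :=
  {A of GRing.Lmodule R[i] A & isUnitalAlg R A}.

Notation "x ** y" := (amul x y) (at level 40, left associativity) : ring_scope.

HB.mixin Record hasStar A := { star : A -> A }.

#[short(type="preStarAlgType")]
HB.structure Definition PreStarAlg (R : realType) :=
  {A of UnitalAlg R A & hasStar A}.

HB.mixin Record isStarAlg (R : realType) A of PreStarAlg R A := {
  starD : forall x y : A, star (x + y) = star x + star y;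
  starZ : forall (a : R[i]) (x : A), star (a *: x) = conjc a *: star x;
  starM : forall x y : A, star (x ** y) = star y ** star x;
  starK : forall x : A, star (star x) = x
}.

#[short(type="starAlgType")]
HB.structure Definition StarAlg (R : realType) :=
  {A of PreStarAlg R A & isStarAlg R A}.

#[short(type="normedPreStarAlgType")]
HB.structure Definition NormedPreStarAlg (R : realType) :=
  {A of PreStarAlg R A & NormedModule R[i] A}.

HB.mixin Record isNormedStarAlg (R : realType) A
    of StarAlg R A & NormedModule R[i] A := {
  norm_amul : forall x y : A, `|x ** y| <= `|x| * `|y|;
  norm_star : forall x : A, `|star x| = `|x|
}.

#[short(type="normedStarAlgType")]
HB.structure Definition NormedStarAlg (R : realType) :=
  {A of StarAlg R A & NormedModule R[i] A & isNormedStarAlg R A}.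

HB.mixin Record isCStarAlg (R : realType) A of NormedStarAlg R A := {
  cstar_identity : forall x : A, `|star x ** x| = `|x| ^+ 2
}.

#[short(type="cstarAlgType")]
HB.structure Definition CStarAlg (R : realType) :=
  {A of NormedStarAlg R A & CompleteNormedModule R[i] A & isCStarAlg R A}.

Section StarNotions.
Variable R : realType.

Definition star_hom (A B : preStarAlgType R) (f : {linear A -> B}) : Prop :=
  (forall x y, f (x ** y) = f x ** f y) /\ (forall x, f (star x) = star (f x)).

Definition unitary (A : preStarAlgType R) (v : A) : Prop :=
  star v ** v = aone /\ v ** star v = aone.

Definition projection (A : preStarAlgType R) (e : A) : Prop :=
  star e = e /\ e ** e = e.

Definition partial_isometry (A : preStarAlgType R) (u : A) : Prop :=
  u ** star u ** u = u.

Definition positive (A : preStarAlgType R) (x : A) : Prop :=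
  exists y : A, x = star y ** y.

End StarNotions.

Section Scalars.
Variable R : realType.
Notation C := (R[i]^o).

Fact cplx_mulZl (a : R[i]) (x y : C) : (a *: x) * y = a *: (x * y).
Proof. by rewrite scalerAl. Qed.
Fact cplx_mulZr (a : R[i]) (x y : C) : x * (a *: y) = a *: (x * y).
Proof. by rewrite scalerAr. Qed.

HB.instance Definition _ := isUnitalAlg.Build R C
  (@mulrA C) (@mul1r C) (@mulr1 C) (@mulrDl C) (@mulrDr C)
  cplx_mulZl cplx_mulZr.
HB.instance Definition _ := hasStar.Build C (@conjc R).

Fact cplx_starD (x y : C) : star (x + y) = star x + star y.
Proof. exact: rmorphD. Qed.
Fact cplx_starZ (a : R[i]) (x : C) : star (a *: x) = conjc a *: star x.
Proof. exact: rmorphM. Qed.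
Fact cplx_starM (x y : C) : star (x ** y) = star y ** star x.
Proof. by rewrite /amul/= mulrC; exact: rmorphM. Qed.
Fact cplx_starK (x : C) : star (star x) = x.
Proof. exact: conjcK. Qed.
HB.instance Definition _ := isStarAlg.Build R C
  cplx_starD cplx_starZ cplx_starM cplx_starK.

Fact cplx_normM (x y : C) : `|x ** y| <= `|x| * `|y|.
Proof. by rewrite normrM. Qed.
Fact cplx_norm_star (x : C) : `|star x| = `|x|.
Proof. by case: x => a b; rewrite /star/= !normc_def /= sqrrN. Qed.
HB.instance Definition _ := isNormedStarAlg.Build R C cplx_normM cplx_norm_star.
End Scalars.

Section MatrixNorm.
Variables (R : realType) (D : normedPreStarAlgType R).

(* The norm of y in the Hilbert D-module D^n. *)
Definition col_norm n (y : 'cV[D]_n) : R :=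
  Num.sqrt (complex.Re `|\sum_i star (y i 0) ** y i 0|).

Definition mx_act n (x : 'M[D]_n) (y : 'cV[D]_n) : 'cV[D]_n :=
  \col_i \sum_j x i j ** y j 0.

(* For a C*-algebra D this is the C*-norm of M_n(D), whose elements are the
   adjointable operators on D^n; for D = R[i]^o it is the operator norm on the
   Euclidean space C^n. *)
Definition mx_norm n (x : 'M[D]_n) : R :=
  sup [set col_norm (mx_act x y) | y in [set y : 'cV[D]_n | col_norm y <= 1]].

End MatrixNorm.

(* The norm of M_1(D) = D is moreover given by the norm of D itself. *)
Definition completely_isometric (R : realType) (C D : normedPreStarAlgType R)
    (f : {linear C -> D}) : Prop :=
  (forall x, `|f x| = `|x|) /\
  forall n (x : 'M[C]_n), mx_norm (map_mx f x) = mx_norm x.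

(* A closed unital subalgebra of C(K), K compact Hausdorff. Uniform limits of
   continuous functions being continuous, it is closed in C(K) iff it is closed
   among all functions for the topology of uniform convergence. *)
Record functionAlgebra (R : realType) := FunctionAlgebra {
  fa_space : topologicalType;
  fa_compact : compact [set: fa_space];
  fa_hausdorff : hausdorff_space fa_space;
  fa_set : set (fa_space -> R[i]^o);
  fa_continuous : forall f, fa_set f -> continuous f;
  fa_cst : forall c : R[i]^o, fa_set (cst c);
  fa_add : forall f g, fa_set f -> fa_set g -> fa_set (f \+ g);
  fa_mul : forall f g, fa_set f -> fa_set g -> fa_set (f \* g);
  fa_closed : closed (fa_set : set {uniform fa_space -> R[i]^o})
}.

Arguments fa_set {R} _ _.

Record selfadjointFunctionAlgebra (R : realType) := SelfadjointFunctionAlgebra {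
  sa_fa :> functionAlgebra R;
  sa_conj : forall f : fa_space sa_fa -> R[i]^o,
    fa_set sa_fa f -> fa_set sa_fa (fun k => conjc (f k))
}.

Record fa_elt (R : realType) (A : functionAlgebra R) := FAElt {
  fa_fun :> fa_space A -> R[i]^o;
  fa_funP : fa_fun \in fa_set A
}.

Coercion fa_elt : functionAlgebra >-> Sortclass.

Section FunctionAlgebraTheory.
Variables (R : realType) (A : functionAlgebra R).
Notation C := (R[i]^o).
Notation K := (fa_space A).

HB.instance Definition _ := [isSub for @fa_fun R A].
HB.instance Definition _ := [Choice of fa_elt A by <:].

Lemma fa_eltP (f g : A) : f =1 g -> f = g.
Proof. by move=> fg; apply: val_inj; apply/funext. Qed.

Fact fa_submod_closed :
  GRing.subsemimod_closed ([in fa_set A] : {pred (K -> C)}).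
Proof.
split; last first.
  move=> c f; rewrite !inE => Af.
  by have := fa_mul (fa_cst A c) Af.
split; first by rewrite inE; exact: (fa_cst A 0).
by move=> f g; rewrite !inE; exact: fa_add.
Qed.

Fact fa_zmod_closed : GRing.zmod_closed ([in fa_set A] : {pred (K -> C)}).
Proof.
have [[A0 AD] AZ] := fa_submod_closed.
by split=> // f g Af Ag; rewrite -scaleN1r; apply: AD => //; apply: AZ.
Qed.

HB.instance Definition _ :=
  GRing.SubChoice_isSubZmodule.Build _ _ (fa_elt A) fa_zmod_closed.
HB.instance Definition _ :=
  GRing.SubZmodule_isSubLmodule.Build _ _ _ (fa_elt A) fa_submod_closed.

Definition fa_of (f : K -> C) (Af : fa_set A f) : A := FAElt (mem_set Af).
Definition fa_prod (f g : A) : A :=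
  fa_of (fa_mul (set_mem (fa_funP f)) (set_mem (fa_funP g))).
Definition fa_one : A := fa_of (fa_cst A 1).

Lemma faD (f g : A) k : (f + g) k = f k + g k. Proof. by []. Qed.
Lemma faZ a (f : A) k : (a *: f) k = a * f k. Proof. by []. Qed.
Lemma faN (f : A) k : (- f) k = - f k. Proof. by []. Qed.
Lemma fa0 k : (0 : A) k = 0. Proof. by []. Qed.

Fact fa_prodA : associative fa_prod.
Proof. by move=> f g h; apply: fa_eltP => k; exact: mulrA. Qed.
Fact fa_prodC : commutative fa_prod.
Proof. by move=> f g; apply: fa_eltP => k; exact: mulrC. Qed.
Fact fa_prod1x : left_id fa_one fa_prod.
Proof. by move=> f; apply: fa_eltP => k; exact: mul1r. Qed.
Fact fa_prodx1 : right_id fa_one fa_prod.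
Proof. by move=> f; apply: fa_eltP => k; exact: mulr1. Qed.
Fact fa_prodDl : left_distributive fa_prod +%R.
Proof. by move=> f g h; apply: fa_eltP => k; exact: mulrDl. Qed.
Fact fa_prodDr : right_distributive fa_prod +%R.
Proof. by move=> f g h; apply: fa_eltP => k; exact: mulrDr. Qed.
Fact fa_prodZl (a : R[i]) (f g : A) : fa_prod (a *: f) g = a *: fa_prod f g.
Proof. by apply: fa_eltP => k; exact/esym/mulrA. Qed.
Fact fa_prodZr (a : R[i]) (f g : A) : fa_prod f (a *: g) = a *: fa_prod f g.
Proof. by apply: fa_eltP => k; exact: mulrCA. Qed.

HB.instance Definition _ := isUnitalAlg.Build R (fa_elt A)
  fa_prodA fa_prod1x fa_prodx1 fa_prodDl fa_prodDr fa_prodZl fa_prodZr.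

Lemma faM (f g : A) k : (f ** g) k = f k * g k. Proof. by []. Qed.
Lemma fa1 k : (aone : A) k = 1. Proof. by []. Qed.

Lemma Re_norm (z : C) : (complex.Re `|z|)%:C = `|z|.
Proof. by rewrite normc_def. Qed.

Lemma Re_norm_ge0 (z : C) : 0 <= complex.Re `|z|.
Proof. by rewrite -lecR Re_norm normr_ge0. Qed.

Lemma fa_bounded (f : A) : exists M : R, forall k, complex.Re `|f k| <= M.
Proof.
have fc : continuous f by exact: fa_continuous (set_mem (fa_funP f)).
have gc : continuous (fun k => complex.Re `|f k| : R^o).
  move=> k; apply/cvgrPdist_lt => e e0.
  have e0' : 0 < e%:C by rewrite ltcR.
  have /cvgrPdist_lt /(_ _ e0') := fc k.
  apply: filterS => l kl.
  rewrite -ltcR; apply: le_lt_trans kl.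
  have -> : (`|complex.Re `|f k| - complex.Re `|f l| |)%:C
     = `| `|f k| - `|f l| | :> C.
    by rewrite -(Re_norm (f k)) -(Re_norm (f l)) -rmorphB /= normc_def /= expr0n /= addr0 sqrtr_sqr.
  exact: ler_dist_dist.
have [K0|K0] := pselect ([set: K] !=set0); last first.
  by exists 0 => k; exfalso; apply: K0; exists k.
have [c _ cmax] := @compact_EVT_max _ R (fun k => complex.Re `|f k|) _ K0 (@fa_compact R A) (continuous_subspaceT gc).
by exists (complex.Re `|f c|) => k; apply: cmax; rewrite inE.
Qed.

Definition fa_norms (f : A) : set R := [set complex.Re `|f k| | k in [set: K]].

Definition fa_norm (f : A) : R[i] := (sup (fa_norms f))%:C.

Lemma fa_norms_has_ubound (f : A) : has_ubound (fa_norms f).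
Proof. by have [M fM] := fa_bounded f; exists M => _ [k _ <-]. Qed.

Lemma fa_norm_ge0 (f : A) : 0 <= fa_norm f.
Proof.
rewrite /fa_norm lecR.
have [[k _]|K0] := pselect ([set: K] !=set0); last first.
  rewrite (_ : fa_norms f = set0) ?sup0//.
  by apply/seteqP; split=> // x [k _ _]; case: K0; exists k.
apply: le_trans (Re_norm_ge0 (f k)) _.
by apply: ub_le_sup; [exact: fa_norms_has_ubound|exists k].
Qed.

Lemma le_fa_norm (f : A) k : `|f k| <= fa_norm f.
Proof.
rewrite -Re_norm lecR.
by apply: ub_le_sup; [exact: fa_norms_has_ubound|exists k].
Qed.

Lemma fa_norm_le (f : A) (c : R[i]) :
  0 <= c -> (forall k, `|f k| <= c) -> fa_norm f <= c.
Proof.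
move=> c0 fc.
have cE : c = (complex.Re c)%:C.
  by case: c c0 {fc} => a b c0; have /= -> := ger0_Im c0.
rewrite cE lecR; have [K0|K0] := pselect ([set: K] !=set0); last first.
  rewrite (_ : fa_norms f = set0) ?sup0//; first by rewrite -lecR -cE.
  by apply/seteqP; split=> // x [k _ _]; case: K0; exists k.
apply: ge_sup; first by have [k _] := K0; exists (complex.Re `|f k|), k.
by move=> _ [k _ <-]; rewrite -lecR Re_norm -cE.
Qed.

Fact fa_ler_normD (f g : A) : fa_norm (f + g) <= fa_norm f + fa_norm g.
Proof.
apply: fa_norm_le => [|k]; first by rewrite addr_ge0 ?fa_norm_ge0.
by rewrite faD (le_trans (ler_normD _ _))// lerD ?le_fa_norm.
Qed.

Fact fa_normM (f g : A) : fa_norm (f ** g) <= fa_norm f * fa_norm g.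
Proof.
apply: fa_norm_le => [|k]; first by rewrite mulr_ge0 ?fa_norm_ge0.
by rewrite faM normrM ler_pM ?le_fa_norm.
Qed.

Fact fa_normr0_eq0 (f : A) : fa_norm f = 0 -> f = 0.
Proof.
move=> f0; apply: fa_eltP => k; apply/eqP; rewrite -normr_eq0.
by rewrite eq_le normr_ge0 andbT -f0 le_fa_norm.
Qed.

Fact fa_normrZ (c : R[i]) (f : A) : fa_norm (c *: f) = `|c| * fa_norm f.
Proof.
have H (d : R[i]) (g : A) : fa_norm (d *: g) <= `|d| * fa_norm g.
  apply: fa_norm_le => [|k]; first by rewrite mulr_ge0 ?fa_norm_ge0.
  by rewrite faZ normrM ler_wpM2l ?le_fa_norm.
apply/eqP; rewrite eq_le H /=.
have [->|c0] := eqVneq c 0.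
  by rewrite normr0 mul0r fa_norm_ge0.
rewrite -ler_pdivlMl ?normr_gt0// -normfV.
by apply: le_trans (H _ _); rewrite scalerA mulVf// scale1r.
Qed.

HB.instance Definition _ := Lmodule_isNormed.Build R[i] (fa_elt A)
  fa_ler_normD fa_normrZ fa_normr0_eq0.

Lemma fa_normE (f : A) : `|f| = fa_norm f. Proof. by []. Qed.

(* The norm of M_n(A) as a subspace of C(K, M_n). *)
Definition fa_mx_norm n (x : 'M[A]_n) : R :=
  sup [set mx_norm (\matrix_(i, j) (x i j k : C)) | k in [set: K]].

End FunctionAlgebraTheory.

Section SelfadjointTheory.
Variables (R : realType) (B : selfadjointFunctionAlgebra R).
Notation C := (R[i]^o).

Definition sa_star (f : B) : B := fa_of (sa_conj (set_mem (fa_funP f))).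
HB.instance Definition _ := hasStar.Build (fa_elt B) sa_star.

Lemma saS (f : B) k : star f k = conjc (f k). Proof. by []. Qed.

Fact sa_starD (f g : B) : star (f + g) = star f + star g.
Proof. by apply: fa_eltP => k; rewrite !(saS, faD) rmorphD. Qed.
Fact sa_starZ (a : R[i]) (f : B) : star (a *: f) = conjc a *: star f.
Proof. by apply: fa_eltP => k; rewrite !(saS, faZ) rmorphM. Qed.
Fact sa_starM (f g : B) : star (f ** g) = star g ** star f.
Proof. by apply: fa_eltP => k; rewrite !(saS, faM) rmorphM mulrC. Qed.
Fact sa_starK (f : B) : star (star f) = f.
Proof. by apply: fa_eltP => k; rewrite !saS conjcK. Qed.
HB.instance Definition _ := isStarAlg.Build R (fa_elt B)
  sa_starD sa_starZ sa_starM sa_starK.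

Fact sa_norm_star (f : B) : `|star f| = `|f|.
Proof.
have H (g : B) : fa_norm (star g) <= fa_norm g.
  apply: fa_norm_le => [|k]; first exact: fa_norm_ge0.
  by rewrite -(cplx_norm_star (star g k)) saS /star/= conjcK le_fa_norm.
by apply/eqP; rewrite !fa_normE eq_le H -{1}(sa_starK f) H.
Qed.
HB.instance Definition _ := isNormedStarAlg.Build R (fa_elt B)
  (@fa_normM R B) sa_norm_star.

End SelfadjointTheory.

Section Dual.
Variables (R : realType) (V : normedModType R[i]).
Notation C := (R[i]^o).

Definition bounded_functional (f : V -> C) : Prop :=
  linear f /\ exists M : R[i], forall x, `|f x| <= M * `|x|.

Record dual := Dual {
  dual_fun :> V -> C;
  dual_funP : dual_fun \in [set f | bounded_functional f]
}.

HB.instance Definition _ := [isSub for dual_fun].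
HB.instance Definition _ := [Choice of dual by <:].

Lemma dual_ext (f g : dual) : f =1 g -> f = g.
Proof. by move=> fg; apply: val_inj; apply/funext. Qed.

Definition dual_of (f : V -> C) (bf : bounded_functional f) : dual :=
  @Dual f (mem_set bf).

Fact dual_submod_closed :
  GRing.subsemimod_closed ([in [set f | bounded_functional f]] : {pred (V -> C)}).
Proof.
split; last first.
  move=> c f; rewrite !inE => -[fl [M fM]]; split.
    move=> a x y; rewrite /GRing.scale/= fl /GRing.scale/=.
    by rewrite mulrDr !mulrA [c * a]mulrC.
  by exists (`|c| * M) => x; rewrite normrM -mulrA ler_wpM2l.
split.
  rewrite inE; split; first by move=> a x y /=; rewrite scaler0 addr0.
  by exists 0 => x; rewrite normr0 mul0r.
move=> f g; rewrite !inE => -[fl [M fM]] [gl [N gN]]; split.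
  by move=> a x y; rewrite /GRing.add/= fl gl scalerDr addrACA.
by exists (M + N) => x; rewrite mulrDl (le_trans (ler_normD _ _))// lerD.
Qed.

Fact dual_zmod_closed :
  GRing.zmod_closed ([in [set f | bounded_functional f]] : {pred (V -> C)}).
Proof.
have [[A0 AD] AZ] := dual_submod_closed.
by split=> // f g Af Ag; rewrite -scaleN1r; apply: AD => //; apply: AZ.
Qed.

HB.instance Definition _ :=
  GRing.SubChoice_isSubZmodule.Build _ _ dual dual_zmod_closed.
HB.instance Definition _ :=
  GRing.SubZmodule_isSubLmodule.Build _ _ _ dual dual_submod_closed.

Lemma dualD (f g : dual) x : (f + g) x = f x + g x. Proof. by []. Qed.
Lemma dualZ a (f : dual) x : (a *: f) x = a * f x. Proof. by []. Qed.

Lemma dual_funL (f : dual) : linear f.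
Proof. by have [] := set_mem (dual_funP f). Qed.
HB.instance Definition _ (f : dual) :=
  GRing.isLinear.Build R[i] V C *:%R f (dual_funL f).

Definition dual_norms (f : dual) : set R :=
  [set complex.Re `|f x| | x in [set x : V | `|x| <= 1]].

Definition dual_norm (f : dual) : R[i] := (sup (dual_norms f))%:C.

Lemma dual_norms_has_sup (f : dual) : has_sup (dual_norms f).
Proof.
split; first by exists (complex.Re `|f 0|), 0 => //=; rewrite normr0 ler01.
have [_ [M fM]] := set_mem (dual_funP f).
exists (complex.Re `|M|) => _ [x /= x1 <-]; rewrite -lecR !Re_norm.
have Mx0 : 0 <= M * `|x| := le_trans (normr_ge0 _) (fM x).
apply: le_trans (fM x) _.
by rewrite -(ger0_norm Mx0) normrM normr_id ler_piMr.
Qed.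

Lemma dual_norm_ge0 (f : dual) : 0 <= dual_norm f.
Proof.
rewrite lecR; apply: le_trans (Re_norm_ge0 (f 0)) _.
apply: ub_le_sup; first by have [] := dual_norms_has_sup f.
by exists 0 => //=; rewrite normr0 ler01.
Qed.

Lemma le_dual_norm (f : dual) x : `|f x| <= dual_norm f * `|x|.
Proof.
have [->|x0] := eqVneq x 0; first by rewrite linear0 !normr0 mulr0.
rewrite -ler_pdivrMr ?normr_gt0//.
have -> : `|f x| / `|x| = `|f (`|x|^-1 *: x)|.
  by rewrite linearZ normrM mulrC ger0_norm// invr_ge0.
rewrite -Re_norm lecR; apply: ub_le_sup.
  by have [] := dual_norms_has_sup f.
exists (`|x|^-1 *: x) => //=.
by rewrite normrZ ger0_norm ?invr_ge0// mulVf ?normr_eq0.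
Qed.

Lemma dual_norm_le (f : dual) (c : R[i]) :
  0 <= c -> (forall x, `|f x| <= c * `|x|) -> dual_norm f <= c.
Proof.
move=> c0 fc.
have cE : c = (complex.Re c)%:C.
  by case: c c0 {fc} => a b c0; have /= -> := ger0_Im c0.
rewrite cE lecR; apply: ge_sup; first by have [] := dual_norms_has_sup f.
move=> _ [x /= x1 <-]; rewrite -lecR Re_norm -cE.
by apply: le_trans (fc x) _; rewrite ler_piMr.
Qed.

Fact dual_ler_normD (f g : dual) : dual_norm (f + g) <= dual_norm f + dual_norm g.
Proof.
apply: dual_norm_le => [|x]; first by rewrite addr_ge0 ?dual_norm_ge0.
by rewrite dualD (le_trans (ler_normD _ _))// mulrDl lerD ?le_dual_norm.
Qed.

Fact dual_normr0_eq0 (f : dual) : dual_norm f = 0 -> f = 0.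
Proof.
move=> f0; apply: dual_ext => x; apply/eqP; rewrite -normr_eq0.
by rewrite eq_le normr_ge0 andbT -(mul0r `|x|) -f0 le_dual_norm.
Qed.

Fact dual_normrZ (c : R[i]) (f : dual) : dual_norm (c *: f) = `|c| * dual_norm f.
Proof.
have H (d : R[i]) (g : dual) : dual_norm (d *: g) <= `|d| * dual_norm g.
  apply: dual_norm_le => [|x]; first by rewrite mulr_ge0 ?dual_norm_ge0.
  by rewrite dualZ normrM -mulrA ler_wpM2l ?le_dual_norm.
apply/eqP; rewrite eq_le H /=.
have [->|c0] := eqVneq c 0.
  by rewrite normr0 mul0r dual_norm_ge0.
rewrite -ler_pdivlMl ?normr_gt0// -normfV.
by apply: le_trans (H _ _); rewrite scalerA mulVf// scale1r.
Qed.

HB.instance Definition _ := Lmodule_isNormed.Build R[i] dual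
  dual_ler_normD dual_normrZ dual_normr0_eq0.

Lemma dual_le (f : dual) x : `|f x| <= `|f| * `|x|.
Proof. exact: le_dual_norm. Qed.

End Dual.

Section Bidual.
Variables (R : realType) (B : normedStarAlgType R).
Notation C := (R[i]^o).

Definition bidual : Type := dual (dual B).
HB.instance Definition _ := NormedModule.copy bidual (dual (dual B)).
Definition bidual_fun (F : bidual) : dual B -> C := dual_fun F.
Coercion bidual_fun : bidual >-> Funclass.
HB.instance Definition _ (F : bidual) :=
  GRing.isLinear.Build R[i] (dual B) C *:%R F (dual_funL F).

Lemma bidual_ext (F G : bidual) : F =1 G -> F = G.
Proof. exact: dual_ext. Qed.

Fact hat_bounded (b : B) : bounded_functional (fun phi : dual B => phi b).
Proof.
split; first by move=> a phi psi.
by exists `|b| => phi; rewrite mulrC dual_le.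
Qed.

Definition hat (b : B) : bidual := dual_of (hat_bounded b).

(* The first Arens product, with <phi.b, c> = <phi, b c>,
   <G.phi, b> = <G, phi.b> and <F G, phi> = <F, G.phi>. *)
Fact dual_act_bounded (phi : dual B) (b : B) :
  bounded_functional (fun c : B => phi (b ** c)).
Proof.
split; first by move=> a x y; rewrite amulDr amulZr linearP.
exists (`|phi| * `|b|) => x; apply: le_trans (dual_le _ _) _.
by rewrite -mulrA ler_wpM2l// norm_amul.
Qed.

Definition dual_act (phi : dual B) (b : B) : dual B :=
  dual_of (dual_act_bounded phi b).

Lemma dual_act_le phi b : `|dual_act phi b| <= `|phi| * `|b|.
Proof.
apply: dual_norm_le => [|x]; first by rewrite mulr_ge0.
apply: le_trans (dual_le phi (b ** x)) _.
by rewrite -mulrA ler_wpM2l// norm_amul.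
Qed.

Fact bidual_act_bounded (G : bidual) (phi : dual B) :
  bounded_functional (fun b : B => G (dual_act phi b)).
Proof.
split.
  move=> a x y.
  have -> : dual_act phi (a *: x + y) = a *: dual_act phi x + dual_act phi y.
    by apply: dual_ext => c /=; rewrite amulDl amulZl linearP.
  exact: dual_funL.
exists (`|G| * `|phi|) => x; apply: le_trans (dual_le _ _) _.
by rewrite -mulrA ler_wpM2l// dual_act_le.
Qed.

Definition bidual_act (G : bidual) (phi : dual B) : dual B :=
  dual_of (bidual_act_bounded G phi).

Lemma bidual_act_le G phi : `|bidual_act G phi| <= `|G| * `|phi|.
Proof.
apply: dual_norm_le => [|x]; first by rewrite mulr_ge0.
apply: le_trans (dual_le G (dual_act phi x)) _.
by rewrite -mulrA ler_wpM2l// dual_act_le.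
Qed.

Fact arens_bounded (F G : bidual) :
  bounded_functional (fun phi : dual B => F (bidual_act G phi)).
Proof.
split.
  move=> a x y.
  have H b : dual_act (a *: x + y) b = a *: dual_act x b + dual_act y b.
    exact: dual_ext.
  have -> : bidual_act G (a *: x + y) = a *: bidual_act G x + bidual_act G y.
    by apply: dual_ext => b /=; rewrite H; exact: dual_funL.
  exact: dual_funL.
exists (`|F| * `|G|) => x; apply: le_trans (dual_le _ _) _.
by rewrite -mulrA ler_wpM2l// bidual_act_le.
Qed.

Definition arens (F G : bidual) : bidual := dual_of (arens_bounded F G).

Fact arensA : associative arens.
Proof.
move=> F G H; apply: bidual_ext => phi; congr (F _); apply: dual_ext => b.
congr (G _); apply: dual_ext => c; congr (H _); apply: dual_ext => d /=.
by rewrite amulA.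
Qed.

Fact arens1x : left_id (hat aone) arens.
Proof.
move=> F; apply: bidual_ext => phi; congr (F _); apply: dual_ext => b /=.
by rewrite amul1x.
Qed.

Fact arensx1 : right_id (hat aone) arens.
Proof.
move=> F; apply: bidual_ext => phi; congr (F _); apply: dual_ext => b /=.
by rewrite -[LHS]/(phi (b ** aone)) amulx1.
Qed.

Fact arensDl : left_distributive arens +%R.
Proof. by move=> F G H; exact: bidual_ext. Qed.

Fact arensDr : right_distributive arens +%R.
Proof.
move=> F G H; apply: bidual_ext => phi; rewrite /=.
have -> : bidual_act (G + H) phi = bidual_act G phi + bidual_act H phi.
  exact: dual_ext.
exact: linearD.
Qed.

Fact arensZl (a : R[i]) (F G : bidual) : arens (a *: F) G = a *: arens F G.
Proof. by apply: bidual_ext. Qed.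

Fact arensZr (a : R[i]) (F G : bidual) : arens F (a *: G) = a *: arens F G.
Proof.
apply: bidual_ext => phi; rewrite /=.
have -> : bidual_act (a *: G) phi = a *: bidual_act G phi by exact: dual_ext.
exact: linearZ.
Qed.

HB.instance Definition _ := isUnitalAlg.Build R bidual
  arensA arens1x arensx1 arensDl arensDr arensZl arensZr.

Lemma conjc_linear (a z w : R[i]) :
  conjc (conjc a * z + w) = a * conjc z + conjc w.
Proof. by rewrite rmorphD rmorphM /= conjcK. Qed.

Fact dual_star_bounded (phi : dual B) :
  bounded_functional (fun b : B => conjc (phi (star b))).
Proof.
split.
  move=> a x y; rewrite starD starZ linearP; exact: conjc_linear.
exists `|phi| => x; rewrite cplx_norm_star -(norm_star x).
exact: dual_le.
Qed.

Definition dual_star (phi : dual B) : dual B :=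
  dual_of (dual_star_bounded phi).

Fact bidual_star_bounded (F : bidual) :
  bounded_functional (fun phi : dual B => conjc (F (dual_star phi))).
Proof.
split.
  move=> a x y.
  have -> : dual_star (a *: x + y) = conjc a *: dual_star x + dual_star y.
    by apply: dual_ext => b /=; rewrite rmorphD rmorphM.
  by rewrite [X in conjc X](dual_funL F); exact: conjc_linear.
exists `|F| => x; rewrite cplx_norm_star.
apply: le_trans (dual_le _ _) _; rewrite ler_wpM2l//.
apply: dual_norm_le => // b; rewrite cplx_norm_star -(norm_star b).
exact: dual_le.
Qed.

Definition bidual_star (F : bidual) : bidual :=
  dual_of (bidual_star_bounded F).

(* Only the star operation of B^** is recorded: its antimultiplicativity is the
   Arens regularity of B. *)
HB.instance Definition _ := hasStar.Build bidual bidual_star.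

Lemma hatM (b c : B) : hat (b ** c) = hat b ** hat c.
Proof. by apply: bidual_ext => phi. Qed.

Lemma hat_star (b : B) : hat (star b) = star (hat b).
Proof. by apply: bidual_ext => phi; rewrite /= conjcK. Qed.

Definition corner (e : bidual) : set bidual :=
  [set e ** F ** e | F in [set: bidual]].

(* The weak-star topology of B^** is that of pointwise convergence on B^*. *)
Definition weak_star_limit (I : Type) (le : I -> I -> Prop)
    (F : I -> bidual) (G : bidual) : Prop :=
  forall (phi : dual B) (eps : R[i]), 0 < eps ->
    exists i0, forall i, le i0 i -> `|F i phi - G phi| < eps.

Definition closed_projection (e : bidual) : Prop :=
  projection e /\
  exists (I : Type) (le : I -> I -> Prop) (b : I -> B),
    [/\ inhabited I,
        (forall i, le i i) /\
          (forall i j k, le i j -> le j k -> le i k),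
        forall i j, exists k, le i k /\ le j k,
        (forall i, positive (b i)) /\
          (forall i j, le i j -> positive (b j - b i)) &
        weak_star_limit le (hat \o b) (aone - e)].

End Bidual.

Section Quotient.
Variables (R : realType) (B : normedStarAlgType R).

Record closedIdeal := ClosedIdeal {
  ideal_set :> B -> Prop;
  ideal0 : ideal_set 0;
  idealD : forall x y, ideal_set x -> ideal_set y -> ideal_set (x + y);
  idealMl : forall b x, ideal_set x -> ideal_set (b ** x);
  idealMr : forall b x, ideal_set x -> ideal_set (x ** b);
  ideal_closed : closed (ideal_set : set B)
}.

Variable I : closedIdeal.

Lemma idealZ (a : R[i]) x : I x -> I (a *: x).
Proof. by move=> /(idealMl (a *: aone)); rewrite amulZl amul1x. Qed.

Lemma idealN x : I x -> I (- x).
Proof. by rewrite -scaleN1r; exact: idealZ. Qed.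

Lemma idealB x y : I x -> I y -> I (x - y).
Proof. by move=> Ix /idealN; exact: idealD. Qed.

Definition ideal_equiv : rel B := fun x y => `[< I (x - y) >].

Fact ideal_equiv_is_equiv : equiv_class_of ideal_equiv.
Proof.
split=> [x|x y|y x z].
- by apply/asboolP; rewrite subrr; exact: ideal0.
- by apply/asboolP/asboolP => /idealN; rewrite opprB.
- move=> /asboolP xy /asboolP yz; apply/asboolP.
  by have := idealD xy yz; rewrite addrA subrK.
Qed.

Canonical ideal_equiv_rel := EquivRelPack ideal_equiv_is_equiv.

Definition quot : Type := {eq_quot ideal_equiv_rel}.
HB.instance Definition _ := Choice.on quot.
HB.instance Definition _ := EqQuotient.on quot.

Definition qpi (x : B) : quot := \pi_quot x.

Lemma qpiP x y : qpi x = qpi y <-> I (x - y).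
Proof.
split=> [/eqP|xy]; first by rewrite /qpi eqmodE => /asboolP.
by apply/eqP; rewrite /qpi eqmodE; apply/asboolP.
Qed.

Lemma qpi_surj (q : quot) : exists x, q = qpi x.
Proof. by exists (repr q); rewrite /qpi reprK. Qed.

Definition quot_add (p q : quot) : quot := qpi (repr p + repr q).
Definition quot_opp (p : quot) : quot := qpi (- repr p).
Definition quot_scale (a : R[i]) (p : quot) : quot := qpi (a *: repr p).
Definition quot_mul (p q : quot) : quot := qpi (repr p ** repr q).
Definition quot_star (p : quot) : quot := qpi (star (repr p)).

Lemma repr_qpi x : I (repr (qpi x) - x).
Proof. by apply/qpiP; rewrite /qpi reprK. Qed.

Lemma qpi_add x y : quot_add (qpi x) (qpi y) = qpi (x + y).
Proof.
by apply/qpiP; rewrite opprD addrACA; apply: idealD; exact: repr_qpi.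
Qed.
Lemma qpi_opp x : quot_opp (qpi x) = qpi (- x).
Proof. by apply/qpiP; rewrite -opprD; apply: idealN; exact: repr_qpi. Qed.
Lemma qpi_scale a x : quot_scale a (qpi x) = qpi (a *: x).
Proof. by apply/qpiP; rewrite -scalerBr; apply: idealZ; exact: repr_qpi. Qed.

Lemma amulNl (x y : B) : (- x) ** y = - (x ** y).
Proof. by rewrite -scaleN1r amulZl scaleN1r. Qed.
Lemma amulNr (x y : B) : x ** (- y) = - (x ** y).
Proof. by rewrite -scaleN1r amulZr scaleN1r. Qed.

Lemma qpi_mul x y : quot_mul (qpi x) (qpi y) = qpi (x ** y).
Proof.
apply/qpiP; set x' := repr _; set y' := repr _.
have -> : x' ** y' - x ** y = (x' - x) ** y' + x ** (y' - y).
  by rewrite amulDl amulDr amulNl amulNr addrA subrK.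
by apply: idealD; [apply: idealMr|apply: idealMl]; exact: repr_qpi.
Qed.

Fact quot_addA : associative quot_add.
Proof.
move=> p q r; have [x ->] := qpi_surj p; have [y ->] := qpi_surj q.
by have [z ->] := qpi_surj r; rewrite !qpi_add addrA.
Qed.
Fact quot_addC : commutative quot_add.
Proof. by move=> p q; rewrite /quot_add addrC. Qed.
Fact quot_add0 : left_id (qpi 0) quot_add.
Proof. by move=> p; have [x ->] := qpi_surj p; rewrite qpi_add add0r. Qed.
Fact quot_addN : left_inverse (qpi 0) quot_opp quot_add.
Proof.
by move=> p; have [x ->] := qpi_surj p; rewrite qpi_opp qpi_add addNr.
Qed.

HB.instance Definition _ :=
  GRing.isZmodule.Build quot quot_addA quot_addC quot_add0 quot_addN.

Lemma qpiD x y : qpi (x + y) = qpi x + qpi y.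
Proof. exact/esym/qpi_add. Qed.

Fact quot_scaleA a b p : quot_scale a (quot_scale b p) = quot_scale (a * b) p.
Proof. by have [x ->] := qpi_surj p; rewrite !qpi_scale scalerA. Qed.
Fact quot_scale1 : left_id 1 quot_scale.
Proof. by move=> p; have [x ->] := qpi_surj p; rewrite qpi_scale scale1r. Qed.
Fact quot_scaleDr : right_distributive quot_scale +%R.
Proof.
move=> a p q; have [x ->] := qpi_surj p; have [y ->] := qpi_surj q.
by rewrite -qpiD !qpi_scale -qpiD scalerDr.
Qed.
Fact quot_scaleDl p : {morph quot_scale^~ p : a b / a + b}.
Proof.
by move=> a b /=; have [x ->] := qpi_surj p; rewrite !qpi_scale -qpiD scalerDl.
Qed.

HB.instance Definition _ := GRing.Zmodule_isLmodule.Build R[i] quot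
  quot_scaleA quot_scale1 quot_scaleDr quot_scaleDl.

Lemma qpiZ a x : qpi (a *: x) = a *: qpi x.
Proof. exact/esym/qpi_scale. Qed.

Fact qpi_linear : linear qpi.
Proof. by move=> a x y; rewrite qpiD qpiZ. Qed.
HB.instance Definition _ := GRing.isLinear.Build R[i] B quot *:%R qpi qpi_linear.

Fact quot_mulA : associative quot_mul.
Proof.
move=> p q r; have [x ->] := qpi_surj p; have [y ->] := qpi_surj q.
by have [z ->] := qpi_surj r; rewrite !qpi_mul amulA.
Qed.
Fact quot_mul1x : left_id (qpi aone) quot_mul.
Proof. by move=> p; have [x ->] := qpi_surj p; rewrite qpi_mul amul1x. Qed.
Fact quot_mulx1 : right_id (qpi aone) quot_mul.
Proof. by move=> p; have [x ->] := qpi_surj p; rewrite qpi_mul amulx1. Qed.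
Fact quot_mulDl : left_distributive quot_mul +%R.
Proof.
move=> p q r; have [x ->] := qpi_surj p; have [y ->] := qpi_surj q.
by have [z ->] := qpi_surj r; rewrite -qpiD !qpi_mul -qpiD amulDl.
Qed.
Fact quot_mulDr : right_distributive quot_mul +%R.
Proof.
move=> p q r; have [x ->] := qpi_surj p; have [y ->] := qpi_surj q.
by have [z ->] := qpi_surj r; rewrite -qpiD !qpi_mul -qpiD amulDr.
Qed.
Fact quot_mulZl (a : R[i]) p q : quot_mul (a *: p) q = a *: quot_mul p q.
Proof.
have [x ->] := qpi_surj p; have [y ->] := qpi_surj q.
by rewrite -qpiZ !qpi_mul -qpiZ amulZl.
Qed.
Fact quot_mulZr (a : R[i]) p q : quot_mul p (a *: q) = a *: quot_mul p q.
Proof.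
have [x ->] := qpi_surj p; have [y ->] := qpi_surj q.
by rewrite -qpiZ !qpi_mul -qpiZ amulZr.
Qed.

HB.instance Definition _ := isUnitalAlg.Build R quot
  quot_mulA quot_mul1x quot_mulx1 quot_mulDl quot_mulDr quot_mulZl quot_mulZr.

(* Closed ideals of a C*-algebra are closed under star, so that this does not
   depend on the representative: see qpi_star below for B a selfadjoint
   function algebra. *)
HB.instance Definition _ := hasStar.Build quot quot_star.

Lemma qpiM x y : qpi (x ** y) = qpi x ** qpi y.
Proof. exact/esym/qpi_mul. Qed.
Lemma qpi1 : qpi aone = aone. Proof. by []. Qed.

End Quotient.

Section SelfadjointQuotient.
Variables (R : realType) (B : selfadjointFunctionAlgebra R).
Variable I : closedIdeal B.
Notation C := (R[i]^o).

Fixpoint apow (x : B) n : B := if n is n'.+1 then x ** apow x n' else aone.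

Lemma apowE x n k : apow x n k = (x k : C) ^+ n.
Proof. by elim: n => // n IHn; rewrite faM exprS IHn. Qed.

Lemma bernoulli_le1 (t : R) n :
  0 <= t <= 1 -> (1 + n%:R * t) * (1 - t) ^+ n <= 1.
Proof.
move=> /andP[t0 t1]; elim: n => [|n IHn]; first by rewrite mul0r addr0 mul1r.
apply: le_trans IHn; rewrite exprS mulrA ler_wpM2r ?exprn_ge0 ?subr_ge0//.
rewrite -subr_ge0.
have -> : 1 + n%:R * t - (1 + n.+1%:R * t) * (1 - t) = n.+1%:R * t ^+ 2.
  by rewrite -[n.+1%:R]natr1; ring.
by rewrite mulr_ge0 ?ler0n ?sqr_ge0.
Qed.

Lemma ideal_subpow (y : B) n : I y -> I (aone - apow (aone - y) n).
Proof.
move=> Iy; elim: n => [|n IHn]; first by rewrite subrr; exact: ideal0.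
rewrite /= amulDl amul1x amulNl opprB addrCA addrC.
by apply: idealD => //; exact: idealMr.
Qed.

Lemma conjc_mul_norm (z : R[i]) :
  conjc z * z = ((complex.Re `|z|) ^+ 2)%:C.
Proof.
case: z => a b; rewrite normc_def /= sqr_sqrtr ?addr_ge0 ?sqr_ge0//.
by apply/eqP; rewrite eq_complex /=; apply/andP; split; apply/eqP; ring.
Qed.

Lemma ideal_star (x : B) : I x -> I (star x).
Proof.
move=> Ix; have [M xM] := fa_bounded x.
pose g k : R := complex.Re `|x k|.
have g0 k : 0 <= g k by exact: Re_norm_ge0.
pose c : R := M ^+ 2 + 1.
have c0 : 0 < c by rewrite ltr_wpDl ?sqr_ge0.
pose t k : R := g k ^+ 2 / c.
have t01 k : 0 <= t k <= 1.
  rewrite divr_ge0 ?sqr_ge0 ?(ltW c0)//= ler_pdivrMr// mul1r.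
  rewrite (@le_trans _ _ (M ^+ 2)) ?lerDl//.
  by rewrite ler_sqr ?nnegrE ?(le_trans (g0 k))// xM.
pose y : B := (c^-1)%:C *: (star x ** x).
have yE k : y k = (t k)%:C.
  by rewrite faZ faM saS conjc_mul_norm -rmorphM /= mulrC.
have Iy : I y by apply: idealZ; exact: idealMl.
apply: (@ideal_closed _ _ I) => N /nbhs_ballP[e e0 eN].
pose r : R := complex.Re e.
have eE : e = r%:C.
  by rewrite /r; case: e e0 {eN r} => p q /= /ltW /ger0_Im /= ->.
have r0 : 0 < r by rewrite -ltcR -eE.
pose n := (Num.truncn (c / (r / 2) ^+ 2)).+1.
pose p := apow (aone - y) n.
exists (star x ** (aone - p)); split.
  by apply: idealMl; exact: ideal_subpow.
apply: eN; rewrite -ball_normE /=.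
have -> : star x - star x ** (aone - p) = star x ** p.
  by rewrite amulDr amulx1 amulNr opprD opprK addrA subrr add0r.
apply: (@le_lt_trans _ _ (r / 2)%:C); last by rewrite eE ltcR gtr_pMr// invf_lt1 ?ltr1n.
apply: fa_norm_le => [|k]; first by rewrite lecR divr_ge0// ltW.
have u0 : 0 <= 1 - t k by rewrite subr_ge0; have /andP[] := t01 k.
have -> : `|(star x ** p) k| = (g k * (1 - t k) ^+ n)%:C.
  rewrite faM normrM (_ : `|star x k| = `|x k|); last exact: cplx_norm_star.
  have E : (aone - y) k = (1 - t k)%:C :> C.
    by rewrite faD faN fa1 yE rmorphB.
  rewrite apowE E [RHS]rmorphM /= Re_norm; congr (_ * _).
  by rewrite normrX ger0_norm ?lecR// rmorphXn.
rewrite lecR -ler_sqr ?nnegrE ?mulr_ge0 ?exprn_ge0 ?invr_ge0 ?(ltW r0)//.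
have -> : (g k * (1 - t k) ^+ n) ^+ 2 = c * (t k * (1 - t k) ^+ n * (1 - t k) ^+ n).
  rewrite /t; set z := (_ ^+ n); field.
  by rewrite gt_eqF.
have /andP[tk0 tk1] := t01 k.
have H1 : n%:R * (t k * (1 - t k) ^+ n) <= 1.
  apply: le_trans (bernoulli_le1 n (t01 k)).
  by rewrite mulrA ler_wpM2r ?exprn_ge0// lerDr.
have H2 : c <= n%:R * (r / 2) ^+ 2.
  by rewrite -ler_pdivrMr ?exprn_gt0 ?divr_gt0// ltW// truncnS_gt.
have v1 : (1 - t k) ^+ n <= 1 by rewrite exprn_ile1// lerBlDr lerDl.
set z := t k * (1 - t k) ^+ n in H1 *.
have z0 : 0 <= z by rewrite mulr_ge0 ?exprn_ge0.
apply: (@le_trans _ _ (c * z)).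
  by rewrite mulrA ler_piMr// mulr_ge0// ltW.
apply: le_trans (_ : n%:R * (r / 2) ^+ 2 * z <= _); first by rewrite ler_wpM2r.
by rewrite mulrAC ler_piMl// sqr_ge0.
Qed.

Lemma qpi_star (x : B) : qpi I (star x) = star (qpi I x).
Proof.
apply/esym/qpiP; rewrite -[- star x]scaleN1r.
have -> : -1 = conjc (-1) :> R[i] by rewrite rmorphN rmorph1.
by rewrite -starZ -starD scaleN1r; apply: ideal_star; exact: repr_qpi.
Qed.

Fact quot_starD (p q : quot I) : star (p + q) = star p + star q.
Proof.
have [x ->] := qpi_surj p; have [y ->] := qpi_surj q.
by rewrite -qpiD -!qpi_star starD qpiD.
Qed.
Fact quot_starZ (a : R[i]) (p : quot I) : star (a *: p) = conjc a *: star p.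
Proof. by have [x ->] := qpi_surj p; rewrite -qpiZ -!qpi_star starZ qpiZ. Qed.
Fact quot_starM (p q : quot I) : star (p ** q) = star q ** star p.
Proof.
have [x ->] := qpi_surj p; have [y ->] := qpi_surj q.
by rewrite -qpiM -!qpi_star starM qpiM.
Qed.
Fact quot_starK (p : quot I) : star (star p) = p.
Proof. by have [x ->] := qpi_surj p; rewrite -!qpi_star starK. Qed.

HB.instance Definition _ := isStarAlg.Build R (quot I)
  quot_starD quot_starZ quot_starM quot_starK.

End SelfadjointQuotient.

Section CStarEnvelope.
Variables (R : realType) (A : functionAlgebra R).

Definition complete_isometry (D : normedStarAlgType R) (i : {linear A -> D}) :
    Prop :=
  forall n (x : 'M[A]_n), mx_norm (map_mx i x) = fa_mx_norm x.

(* No proper closed star-subalgebra of D contains the range of i. *)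
Definition generates (D : normedStarAlgType R) (i : {linear A -> D}) : Prop :=
  forall S : set D,
    closed S ->
    (forall a, S (i a)) ->
    (forall x y, S x -> S y -> S (x + y)) ->
    (forall (c : R[i]) x, S x -> S (c *: x)) ->
    (forall x y, S x -> S y -> S (x ** y)) ->
    (forall x, S x -> S (star x)) ->
    S = [set: D].

Definition cstar_cover (D : cstarAlgType R) (i : {linear A -> D}) : Prop :=
  [/\ complete_isometry i, i aone = aone & generates i].

Definition cstar_envelope (C : cstarAlgType R) (j : {linear A -> C}) : Prop :=
  cstar_cover j /\
  forall (D : cstarAlgType R) (i : {linear A -> D}), cstar_cover i ->
    exists theta : {linear D -> C}, star_hom theta /\ forall a, theta (i a) = j a.

End CStarEnvelope.

(* Main.v *)
Require Import Defs.
From HB Require Import structures.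
From mathcomp Require Import all_boot all_order all_algebra.
From mathcomp Require Import complex boolp classical_sets functions.
From mathcomp Require Import reals topology normedtype.
From mathcomp Require Import ring lra.

Set Implicit Arguments.
Unset Strict Implicit.
Unset Printing Implicit Defensive.

Import Order.TTheory GRing.Theory Num.Theory.
Import numFieldNormedType.Exports.
Local Open Scope classical_set_scope.
Local Open Scope ring_scope.

(** Let [I] be the closed ideal of those [b] in [B] with [hat b ** e = 0]. The
    map [cut e : b |-> hat b ** e] is a star-homomorphism from [B] to [B^**]
    with kernel [I], so [B/I] is a copy of the range of [cut e], and it is
    enough to find [u] and the range of [pi] inside that range.

    For [u] this is immediate: [j 1 = 1] and [pi 1 = e = u^* u] give
    [hat (T 1) ** e = u ** pi 1 = u u^* u = u]. Put [v = q_I (T 1)]; the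
    equation [u^* u = e] says that [v] is unitary. Moreover
    [pi (j a) = u^* ** hat (T a) = cut e ((T 1)^* (T a))], so [pi] maps [j A]
    into the range of [cut e]. As [j A] generates [C] and [pi] is isometric, all
    of [pi C] lies there as soon as that range is a norm-closed
    star-subalgebra ([range_cut_closed]). Then [rho], the composite of [pi] with
    the inverse of [B/I -> range (cut e)], is the required homomorphism.

    General theory makes the range of a star-homomorphism of C-star algebras
    closed. The second dual is here only a Banach algebra with a star
    operation, so the proof is direct: every [b] in [B] with
    [|cut e b| <= r] agrees, up to an error of norm [r / 3] after cutting, with
    some [c] in [B] of norm at most [r] ([approximate_lift]). One takes for [c]
    the product of [b] with a power of [1 - s b^* b] with a small [s > 0]: the
    power is small where [|b|] is much larger than [r], and close to 1 after
    cutting, since [|cut e (b^* b)| <= r^2]. As in the proof of the open mapping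
    theorem, a geometric series of such approximations then lifts each limit of
    elements of the range.

    The elements of [B^**] in this argument are all of the form [hat b ** e]
    or lie in the image of [B]; the latter is central ([hat_arensC]), and its
    products with arbitrary elements are compatible with the star
    ([star_hat_arens]), which gives the algebra of [cut e]. *)

(** * Norms as real numbers *)

Section RealNorm.
Variable R : realType.

(** Norms of complex normed spaces take their values in [R[i]], whose order is
    partial; as elements of [R] they become available to linear arithmetic. *)
Definition rnorm (V : normedZmodType R[i]) (x : V) : R := complex.Re `|x|.

Lemma rnormE (V : normedZmodType R[i]) (x : V) : (rnorm x)%:C%C = `|x|.
Proof.
by rewrite /rnorm; case: `|x| (normr_ge0 x) => a b /ger0_Im /= ->.
Qed.

Lemma rnorm_le (V W : normedZmodType R[i]) (x : V) (y : W) :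
  `|x| <= `|y| -> rnorm x <= rnorm y.
Proof. by rewrite -!rnormE lecR. Qed.

Lemma rnorm_ge0 (V : normedZmodType R[i]) (x : V) : 0 <= rnorm x.
Proof. by rewrite -lecR rnormE normr_ge0. Qed.

Lemma ler_rnormD (V : normedZmodType R[i]) (x y : V) :
  rnorm (x + y) <= rnorm x + rnorm y.
Proof. by rewrite -lecR rmorphD /= !rnormE ler_normD. Qed.

Lemma rnormN (V : normedZmodType R[i]) (x : V) : rnorm (- x) = rnorm x.
Proof. by rewrite /rnorm normrN. Qed.

Lemma rnorm0 (V : normedZmodType R[i]) : rnorm (0 : V) = 0.
Proof. by rewrite /rnorm normr0. Qed.

Lemma rnorm_le0 (V : normedZmodType R[i]) (x : V) : rnorm x <= 0 -> x = 0.
Proof. by rewrite -lecR rnormE normr_le0 => /eqP. Qed.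

Lemma rnormZ (V : normedModType R[i]) (a : R) (x : V) :
  0 <= a -> rnorm (a%:C%C *: x) = a * rnorm x.
Proof.
move=> a0; apply: complexI; rewrite rmorphM /= !rnormE normrZ ger0_norm//.
by rewrite lecR.
Qed.

Lemma gt0_complexE (e : R[i]) : 0 < e -> exists2 r : R, 0 < r & e = r%:C%C.
Proof.
case: e => a b e0; exists a; last by have /= -> := ger0_Im (ltW e0).
by move: e0; rewrite ltcE => /andP[].
Qed.

Lemma closure_rnormP (V : normedModType R[i]) (S : set V) x :
  closure S x <->
  forall eps : R, 0 < eps -> exists2 y, S y & rnorm (x - y) < eps.
Proof.
split=> [Sx eps eps0|Sx N /nbhs_ballP[_ /gt0_complexE[e e0 ->] eN]].
  have e0 : 0 < eps%:C%C :> R[i] by rewrite ltcR.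
  have [y [Sy]] := Sx _ (nbhsx_ballx x _ e0).
  by rewrite -ball_normE /= -rnormE ltcR => xy; exists y.
have [y Sy xy] := Sx e e0; exists y; split=> //; apply: eN.
by rewrite -ball_normE /= -rnormE ltcR.
Qed.

Lemma le0_geometric (x c : R) : (forall n, x <= c / 2 ^+ n) -> x <= 0.
Proof.
move=> xc; rewrite leNgt; apply/negP => x0.
have := xc (Num.truncn (c / x)).+1; apply/negP; rewrite -ltNge.
rewrite ltr_pdivrMr ?exprn_gt0// -ltr_pdivrMl// mulrC.
apply: lt_trans (truncnS_gt (c / x)) _.
by rewrite -natrX ltr_nat ltn_expl.
Qed.

End RealNorm.

(** * Limits of geometrically Cauchy sequences *)

Section GeometricLimits.
Variable R : realType.

(** With [d n = 2 c / 2 ^ n], the sequence [u n - d n] increases, [u n + d n]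
    decreases, and the former stays below the latter: the supremum of the
    former is the limit. *)
Lemma real_geometric_limit (u : nat -> R) (c : R) :
  (forall n, `|u n.+1 - u n| <= c / 2 ^+ n) ->
  exists l, forall n, `|l - u n| <= c * 2 / 2 ^+ n.
Proof.
move=> uc.
pose d n := c * 2 / 2 ^+ n.
have dS n : d n = d n.+1 + c / 2 ^+ n.
  by rewrite /d exprS; field; rewrite ?expf_neq0 ?pnatr_eq0.
have d0 n : 0 <= d n.
  rewrite /d mulrAC mulr_ge0// (le_trans _ (uc n))//.
have lo n m : u n - d n <= u (n + m)%N - d (n + m)%N.
  elim: m => [|m IHm]; first by rewrite addn0.
  apply: le_trans IHm _; rewrite addnS.
  have := uc (n + m)%N; rewrite ler_norml [d (n + m)%N]dS => /andP[]; lra.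
have hi n m : u (n + m)%N + d (n + m)%N <= u n + d n.
  elim: m => [|m IHm]; first by rewrite addn0.
  apply: le_trans _ IHm; rewrite addnS.
  have := uc (n + m)%N; rewrite ler_norml [d (n + m)%N]dS => /andP[]; lra.
have lohi n m : u n - d n <= u m + d m.
  apply: le_trans (lo n m) _; apply: le_trans _ (hi m n).
  rewrite [(m + n)%N]addnC; have := d0 (n + m)%N; lra.
pose S := [set u n - d n | n in [set: nat]].
have Sub m : ubound S (u m + d m) by move=> _ [n _ <-].
exists (sup S) => n; rewrite ler_norml -/(d n).
have h1 : u n - d n <= sup S.
  by apply: ub_le_sup; [exists (u 0%N + d 0%N)|exists n].
have h2 : sup S <= u n + d n.
  by apply: ge_sup; [exists (u 0%N - d 0%N), 0%N|].
by apply/andP; split; lra.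
Qed.

Lemma Re_le_rnorm (z : R[i]) : `|complex.Re z| <= rnorm z.
Proof.
case: z => a b; rewrite /rnorm normc_def /= -sqrtr_sqr.
rewrite ler_sqrt ?addr_ge0 ?sqr_ge0//.
by rewrite lerDl sqr_ge0.
Qed.

Lemma Im_le_rnorm (z : R[i]) : `|complex.Im z| <= rnorm z.
Proof.
case: z => a b; rewrite /rnorm normc_def /= -sqrtr_sqr.
rewrite ler_sqrt ?addr_ge0 ?sqr_ge0//.
by rewrite lerDr sqr_ge0.
Qed.

Lemma rnorm_le_ReIm (z : R[i]) :
  rnorm z <= `|complex.Re z| + `|complex.Im z|.
Proof.
case: z => a b; rewrite /rnorm normc_def /=.
rewrite -[leRHS]ger0_norm ?addr_ge0// -sqrtr_sqr ler_sqrt ?sqr_ge0//.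
rewrite sqrrD !real_normK ?num_real// -addrA lerD2l lerDr.
by rewrite mulrn_wge0// mulr_ge0.
Qed.

Lemma complex_geometric_limit (u : nat -> R[i]) (c : R) :
  (forall n, rnorm (u n.+1 - u n) <= c / 2 ^+ n) ->
  exists l, forall n, rnorm (l - u n) <= c * 4 / 2 ^+ n.
Proof.
move=> uc.
have [|a ha] := @real_geometric_limit (fun n => complex.Re (u n)) c.
  by move=> n; rewrite -raddfB (le_trans (Re_le_rnorm _)).
have [|b hb] := @real_geometric_limit (fun n => complex.Im (u n)) c.
  by move=> n; rewrite -raddfB (le_trans (Im_le_rnorm _)).
exists (a +i* b)%C => n; apply: le_trans (rnorm_le_ReIm _) _.
rewrite !raddfB /=; have := lerD (ha n) (hb n); move/le_trans; apply.
by rewrite -mulrDl -mulrDr -natrD lexx.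
Qed.

(** The pointwise limit is a uniform one, and a function algebra is closed under
    uniform limits. *)
Lemma fa_geometric_limit (A : functionAlgebra R) (b : nat -> A) (c : R) :
  (forall n, rnorm (b n.+1 - b n) <= c / 2 ^+ n) ->
  exists l : A, forall n, rnorm (l - b n) <= c * 4 / 2 ^+ n.
Proof.
move=> bc.
have pt k : exists z : R[i], forall n, rnorm (z - b n k) <= c * 4 / 2 ^+ n.
  apply: complex_geometric_limit => n; apply: le_trans (bc n).
  by apply: rnorm_le; exact: (le_fa_norm (b n.+1 - b n)).
have [f fb] := choice pt.
have c0 : 0 <= c by have := le_trans (rnorm_ge0 _) (bc 0%N); rewrite divr1.
have Af : fa_set A f.
  apply: (@fa_closed _ A) => N /uniform_nbhs[E [entE EN]].
  move: entE; rewrite -entourage_ballE => -[_ /gt0_complexE[e e0 ->] eE].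
  have [n fn] : exists n, c * 4 / 2 ^+ n < e.
    apply: contrapT => /forallNP Nn; move: e0; rewrite ltNge.
    apply/negP/negPn; apply: (@le0_geometric _ _ (c * 4)) => n.
    by rewrite leNgt; exact/negP.
  exists (b n : fa_space A -> R[i]^o); split.
    exact: set_mem (fa_funP (b n)).
  apply: EN => k _; apply: eE; rewrite -ball_normE /=.
  by rewrite -rnormE ltcR (le_lt_trans (fb k n)).
exists (fa_of Af) => n.
rewrite -lecR rnormE; apply: fa_norm_le => [|k].
  by rewrite lecR !mulr_ge0 ?invr_ge0 ?exprn_ge0.
by rewrite -rnormE lecR; exact: fb.
Qed.

End GeometricLimits.

(** * The Arens product with elements of the algebra *)

Section ArensProduct.
Variables (R : realType) (B : normedStarAlgType R).
Implicit Types (b c : B) (F G : bidual B).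

Lemma hatD b c : hat (b + c) = hat b + hat c.
Proof. by apply: bidual_ext => phi; exact: (linearD phi). Qed.

Lemma hatZ (a : R[i]) b : hat (a *: b) = a *: hat b.
Proof. by apply: bidual_ext => phi; rewrite -[LHS]/(phi (a *: b)) linearZ. Qed.

Lemma rnorm_hat b : rnorm (hat b) <= rnorm b.
Proof.
rewrite -lecR !rnormE; apply: dual_norm_le => // phi.
by rewrite mulrC; exact: dual_le.
Qed.

Lemma rnorm_arens F G : rnorm (F ** G) <= rnorm F * rnorm G.
Proof.
rewrite -lecR rmorphM /= !rnormE; apply: dual_norm_le => [|phi].
  by rewrite mulr_ge0.
apply: le_trans (dual_le F (bidual_act G phi)) _.
by rewrite -mulrA ler_wpM2l// bidual_act_le.
Qed.

Lemma rnorm_bidual_star F : rnorm (star F) <= rnorm F.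
Proof.
rewrite -lecR !rnormE; apply: dual_norm_le => // phi.
rewrite cplx_norm_star; apply: le_trans (dual_le F (dual_star phi)) _.
rewrite ler_wpM2l//; apply: dual_norm_le => // b.
by rewrite cplx_norm_star -(norm_star b); exact: dual_le.
Qed.

(** Both sides send [phi] to the conjugate of the value of [F] at the functional
    [c |-> conj (phi (c^* b^* ))]. For two arbitrary factors such an identity
    would express the Arens regularity of [B]. *)
Lemma star_hat_arens b F : star (hat b ** F) = star F ** hat (star b).
Proof.
apply: bidual_ext => phi /=; congr (conjc (F _)); apply: dual_ext => c /=.
by rewrite starM.
Qed.

(** Both products send [phi] to the value of [F] at the functional
    [c |-> phi (b c)], respectively [c |-> phi (c b)]. *)
Lemma hat_arensC b F : commutative (@amul R B) -> hat b ** F = F ** hat b.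
Proof.
move=> BC; apply: bidual_ext => phi; congr (F _); apply: dual_ext => c /=.
by rewrite BC.
Qed.

End ArensProduct.

(** * Cutting a function algebra by a projection of its second dual *)

Section Cut.
Variables (R : realType) (B : selfadjointFunctionAlgebra R).
Variable e : bidual B.
Hypothesis eP : projection e.
Implicit Types b c : B.

Definition cut b : bidual B := hat b ** e.

Lemma cutD b c : cut (b + c) = cut b + cut c.
Proof. by rewrite /cut hatD amulDl. Qed.

Lemma cutZ (a : R[i]) b : cut (a *: b) = a *: cut b.
Proof. by rewrite /cut hatZ amulZl. Qed.

Lemma cutB b c : cut (b - c) = cut b - cut c.
Proof. by rewrite cutD -scaleN1r cutZ scaleN1r. Qed.

Lemma cut0 : cut 0 = 0.
Proof. by rewrite -(subrr 0) cutB subrr. Qed.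

Lemma cut1 : cut aone = e.
Proof. exact: amul1x. Qed.

Lemma cutM b c : cut (b ** c) = cut b ** cut c.
Proof.
have [_ ee] := eP.
rewrite /cut hatM (hat_arensC c e (@fa_prodC R B)) amulA -(amulA (hat b) e e) ee.
by rewrite -!amulA (hat_arensC c e (@fa_prodC R B)).
Qed.

Lemma cut_star b : cut (star b) = star (cut b).
Proof.
by rewrite /cut star_hat_arens (proj1 eP) (hat_arensC _ _ (@fa_prodC R B)).
Qed.

Lemma rnorm_cut b : rnorm (cut b) <= rnorm b * rnorm e.
Proof.
apply: le_trans (rnorm_arens _ _) _.
by rewrite ler_wpM2r ?rnorm_ge0 ?rnorm_hat.
Qed.

Fact annihilatorD b c : cut b = 0 -> cut c = 0 -> cut (b + c) = 0.
Proof. by rewrite cutD => -> ->; rewrite addr0. Qed.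

Fact annihilatorMl b c : cut c = 0 -> cut (b ** c) = 0.
Proof.
by rewrite cutM => ->; rewrite -(scale0r (0 : bidual B)) amulZr !scale0r.
Qed.

Fact annihilatorMr b c : cut c = 0 -> cut (c ** b) = 0.
Proof.
by rewrite cutM => ->; rewrite -(scale0r (0 : bidual B)) amulZl !scale0r.
Qed.

Fact annihilator_closed : closed ([set b | cut b = 0] : set B).
Proof.
move=> b /closure_rnormP bP; apply: rnorm_le0; apply/ler_addgt0Pl => d d0.
rewrite addr0.
have [|c c0 bc] := bP (d / (rnorm e + 1)).
  by rewrite divr_gt0// ltr_wpDl// rnorm_ge0.
rewrite -[cut b]subr0 -c0 -cutB; apply: le_trans (rnorm_cut _) _.
have e0 := rnorm_ge0 e.
move: bc; rewrite ltr_pdivlMr ?ltr_wpDl// mulrDr mulr1.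
have := rnorm_ge0 (b - c); lra.
Qed.

Definition annihilator : closedIdeal B :=
  ClosedIdeal cut0 annihilatorD annihilatorMl annihilatorMr annihilator_closed.

Lemma qpi_cutP b c : qpi annihilator b = qpi annihilator c <-> cut b = cut c.
Proof.
split=> [/qpiP /=|bc]; last by apply/qpiP; rewrite /= cutB bc subrr.
by rewrite cutB => /eqP; rewrite subr_eq0 => /eqP.
Qed.

(** The lift is [b y ^ n] with [y = 1 - s b^* b] and [4 n s r ^ 2 = 1], where
    [n] is so large that [0 <= y <= 1].
    At a point where [|b| = g] and [x = s g ^ 2], the inequality of Bernoulli
    gives [(1 - x) ^ n <= 1 / (1 + n x)] with [n x = g ^ 2 / (4 r ^ 2)], and
    [g <= r (1 + g ^ 2 / (4 r ^ 2))] is [0 <= (g - 2 r) ^ 2]: the lift has norm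
    at most [r].
    After cutting, [b^* b] has norm at most [r ^ 2], so that each of the [n]
    factors [y] adds at most [s r ^ 2 (1 + 1 / 3) = 1 / (3 n)] to the distance
    between [1] and the power of [y]. *)
Lemma approximate_lift b (r : R) : 0 < r -> rnorm (cut b) <= r ->
  exists c, rnorm c <= r /\ rnorm (cut (b - c)) <= r / 3.
Proof.
move=> r0 br.
have [n n0 bn] : exists2 n : nat,
    (0 : R) < n%:R & rnorm b ^+ 2 / r ^+ 2 <= n%:R.
  exists (Num.truncn (rnorm b ^+ 2 / r ^+ 2)).+1; first by rewrite ltr0n.
  by rewrite ltW// truncnS_gt.
pose s : R := (4 * n%:R * r ^+ 2)^-1.
have s0 : 0 < s by rewrite invr_gt0 !mulr_gt0 ?exprn_gt0.
pose t : B := star b ** b.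
pose y : B := aone - s%:C%C *: t.
pose d k : B := aone - apow y k.
have tr : rnorm (cut t) <= r ^+ 2.
  rewrite cutM cut_star; apply: le_trans (rnorm_arens _ _) _.
  rewrite expr2 ler_pM ?rnorm_ge0//.
  exact: le_trans (rnorm_bidual_star _) br.
have dS k : cut (d k.+1) =
    cut (d k) - s%:C%C *: (cut t ** cut (d k)) + s%:C%C *: cut t.
  rewrite -cutM -!cutZ -cutB -cutD; congr cut.
  rewrite /d /= {2 3}/y; apply: fa_eltP => x.
  rewrite !(faD, faN, faZ, faM, fa1); ring.
have dk k : (k <= n)%N -> rnorm (cut (d k)) <= k%:R / (3 * n%:R).
  elim: k => [|k IHk] kn.
    by rewrite /d /= subrr cut0 rnorm0 mul0r.
  have {}IHk := IHk (ltnW kn).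
  have IH1 : rnorm (cut (d k)) <= 1 / 3.
    apply: le_trans IHk _; rewrite ler_pdivrMr ?mulr_gt0//.
    have : k%:R <= n%:R :> R by rewrite ler_nat ltnW.
    lra.
  have sE : s * r ^+ 2 = (4 * n%:R)^-1.
    by rewrite /s; field; rewrite !lt0r_neq0.
  rewrite dS; apply: le_trans (ler_rnormD _ _) _.
  apply: le_trans (lerD (ler_rnormD _ _) (lexx _)) _.
  rewrite rnormN !rnormZ ?(ltW s0)//.
  have h1 : s * rnorm (cut t) <= (4 * n%:R)^-1 by rewrite -sE ler_wpM2l// ltW.
  have h2 : s * rnorm (cut t ** cut (d k)) <= (4 * n%:R)^-1 / 3.
    apply: le_trans (ler_wpM2l (ltW s0) (rnorm_arens _ _)) _.
    rewrite mulrA -[3^-1]div1r.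
    rewrite ler_pM ?rnorm_ge0 ?mulr_ge0 ?rnorm_ge0 ?(ltW s0)//.
  have -> : k.+1%:R / (3 * n%:R)
      = k%:R / (3 * n%:R) + (4 * n%:R)^-1 / 3 + (4 * n%:R)^-1 :> R.
    by rewrite -natr1; field; rewrite lt0r_neq0.
  by rewrite !lerD.
exists (b ** apow y n); split; last first.
  have -> : b - b ** apow y n = b ** d n.
    by rewrite /d amulDr amulx1 amulNr.
  rewrite cutM; apply: le_trans (rnorm_arens _ _) _.
  rewrite ler_pM ?rnorm_ge0//; apply: le_trans (dk n (leqnn n)) _.
  by rewrite ler_pdivrMr ?mulr_gt0//; lra.
rewrite -lecR rnormE; apply: fa_norm_le => [|k]; first by rewrite lecR ltW.
pose g := rnorm (b k).
have g0 : 0 <= g by exact: rnorm_ge0.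
have gb : g <= rnorm b by apply: rnorm_le; exact: (le_fa_norm b).
pose x := s * g ^+ 2.
have yk : y k = (1 - x)%:C%C.
  rewrite faD faN fa1 faZ faM saS conjc_mul_norm -rmorphM /= -/(rnorm _).
  by rewrite rmorphB.
have nx : n%:R * x = g ^+ 2 / (4 * r ^+ 2).
  by rewrite /x /s; field; rewrite !lt0r_neq0.
have x01 : 0 <= x <= 1.
  rewrite mulr_ge0 ?sqr_ge0 ?(ltW s0)//=.
  have := bn; rewrite ler_pdivrMr ?exprn_gt0// => nb.
  rewrite /x mulrC ler_pdivrMr ?mulr_gt0 ?exprn_gt0// mul1r.
  have : g ^+ 2 <= rnorm b ^+ 2 by rewrite ler_sqr ?nnegrE// rnorm_ge0.
  have : 0 <= rnorm b ^+ 2 by rewrite sqr_ge0.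
  rewrite -mulrA; lra.
have /andP[x0 x1] := x01.
rewrite faM normrM apowE normrX yk [`|(1 - x)%:C%C|]ger0_norm ?lecR ?subr_ge0//.
rewrite -rnormE -/g -rmorphXn -rmorphM /= lecR.
have p0 : 0 <= (1 - x) ^+ n by rewrite exprn_ge0// subr_ge0.
have gr : g <= r * (1 + n%:R * x).
  rewrite nx -subr_ge0.
  have -> : r * (1 + g ^+ 2 / (4 * r ^+ 2)) - g = (g - 2 * r) ^+ 2 / (4 * r).
    by field; rewrite lt0r_neq0.
  by rewrite divr_ge0 ?sqr_ge0// mulr_ge0// ltW.
apply: le_trans (ler_wpM2r p0 gr) _.
rewrite -mulrA ler_piMr ?(ltW r0)//.
exact: bernoulli_le1.
Qed.

(** From [s n] in [B] with [|F - cut (s n)| <= r / 2 ^ n], approximate [F] by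
    some [cut b] within an eighth of that bound and add to [s n] an approximate lift
    of [b - s n]. The new error is at most [(9 / 8) / 3 + 1 / 8 = 1 / 2] of the
    bound, and the correction at most [9 / 8] of it: the [s n] converge in [B],
    and the cut of their limit is [F]. *)
Lemma range_cut_closed : closed [set cut b | b in [set: B]].
Proof.
move=> F /closure_rnormP FP.
pose r := rnorm F + 1.
have r0 : 0 < r by rewrite ltr_wpDl// rnorm_ge0.
(* the bound is a hypothesis on c', so that the choice of c' is total *)
have step (cn : B * nat) : exists c', rnorm (F - cut cn.1) <= r / 2 ^+ cn.2 ->
    rnorm (c' - cn.1) <= r * 2 / 2 ^+ cn.2 /\
    rnorm (F - cut c') <= r / 2 ^+ cn.2.+1.
  case: cn => c n /=.
  have [Fc|] := pselect (rnorm (F - cut c) <= r / 2 ^+ n); last by exists c.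
  pose q := r / 2 ^+ n; rewrite -/q in Fc.
  have q0 : 0 < q by rewrite divr_gt0// exprn_gt0.
  have [|_ [b _ <-] Fb] := FP (q / 8); first by rewrite divr_gt0.
  have [||a [a1 a2]] := @approximate_lift (b - c) (q * 9 / 8).
  - lra.
  - rewrite cutB (_ : cut b - cut c = (F - cut c) - (F - cut b)); last first.
      by rewrite opprB [RHS]addrC subrKA.
    apply: le_trans (ler_rnormD _ _) _; rewrite rnormN; lra.
  exists (c + a) => _; rewrite (addrC c) addrK.
  (* the bounds are twice and half of q *)
  rewrite mulrAC -/q exprS invfM mulrCA -/q; split; first lra.
  rewrite (_ : F - cut (a + c) = (F - cut b) + cut (b - c - a)); last first.
    by rewrite !cutB cutD opprD !addrA subrK addrAC.
  apply: le_trans (ler_rnormD _ _) _; lra.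
have [f fP] := choice step.
pose s := fix s n : B := if n is n'.+1 then f (s n', n') else 0.
have sF n : rnorm (F - cut (s n)) <= r / 2 ^+ n.
  elim: n => [|n IHn]; first by rewrite /= cut0 subr0 divr1 lerDl.
  by have [_] := fP (s n, n) IHn.
have [b bs] : exists b : B, forall n, rnorm (b - s n) <= r * 2 * 4 / 2 ^+ n.
  by apply: fa_geometric_limit => n; have [] := fP (s n, n) (sF n).
exists b => //; apply/esym/eqP; rewrite -subr_eq0; apply/eqP/rnorm_le0.
apply: (@le0_geometric _ _ (r + r * 2 * 4 * rnorm e)) => n.
rewrite (_ : F - cut b = (F - cut (s n)) - cut (b - s n)); last first.
  by rewrite cutB opprB addrA subrK.
apply: le_trans (ler_rnormD _ _) _; rewrite rnormN mulrDl lerD//.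
apply: le_trans (rnorm_cut _) _; rewrite mulrAC ler_wpM2r ?rnorm_ge0//.
Qed.

End Cut.

(** * The homomorphism into the quotient *)

Theorem corollary3p2 (R : realType)
    (A : functionAlgebra R) (B : selfadjointFunctionAlgebra R)
    (T : {linear A -> B}) (T_contraction : forall a : A, `|T a| <= `|a|)
    (C : cstarAlgType R) (j : {linear A -> C}) (C_envelope : cstar_envelope j) :
  (exists (u e : bidual B) (pi : {linear C -> bidual B}),
      [/\ partial_isometry u /\ star u ** u = e,
          closed_projection e,
          [/\ star_hom pi, injective pi, completely_isometric pi, pi aone = e &
              forall x : C, corner e (pi x)],
          forall a : A, hat (T a) ** e = u ** pi (j a) &
          forall a : A, pi (j a) = star u ** hat (T a)]) ->
  exists (I : closedIdeal B) (v : quot I) (rho : {linear C -> quot I}),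
    [/\ unitary v,
        star_hom rho,
        rho aone = aone,
        injective rho &
        forall a : A, qpi I (T a) = v ** rho (j a)].
Proof.
move=> [u [e [pi [[uuu uue] [eP _] [[piM piS] pi_inj [pi_iso _] pi1 _] Tu uT]]]].
have [[_ j1 j_gen] _] := C_envelope.
have uE : u = cut e (T aone).
  by rewrite /cut Tu j1 pi1 -uue amulA.
have BC : commutative (@amul R B) := @fa_prodC R B.
have pij a : pi (j a) = cut e (star (T aone) ** T a).
  rewrite uT uE -cut_star// /cut hatM -!amulA; congr (_ ** _).
  by rewrite hat_arensC.
(* the x for which this holds form a closed star-subalgebra containing j A *)
have lift x : exists b, pi x = cut e b.
  suff : [set x | exists b, pi x = cut e b] = [set: C].
    by move/seteqP=> [_ /(_ x)]; apply.
  apply: j_gen.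
  - move=> y /closure_rnormP yP.
    have [|b _ cb] := @range_cut_closed _ _ e eP (pi y); last by exists b.
    apply/closure_rnormP => d /yP[z [b zb] yz]; exists (pi z); first by exists b.
    by rewrite -linearB /rnorm pi_iso.
  - by move=> a; exists (star (T aone) ** T a); exact: pij.
  - by move=> y z [b yb] [c zc]; exists (b + c); rewrite linearD yb zc cutD.
  - by move=> a y [b yb]; exists (a *: b); rewrite linearZ /= yb cutZ.
  - by move=> y z [b yb] [c zc]; exists (b ** c); rewrite piM yb zc cutM.
  - by move=> y [b yb]; exists (star b); rewrite piS yb cut_star.
have [g gP] := choice lift.
pose I := annihilator eP.
(* the class of g x is the preimage of pi x under B/I -> range (cut e) *)
have rhoE x b : pi x = cut e b -> qpi I (g x) = qpi I b.
  by move=> xb; apply/qpi_cutP; rewrite -gP.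
have rho_lin : linear (fun x => qpi I (g x)).
  move=> a x y; rewrite -qpiZ -qpiD; apply: rhoE.
  by rewrite linearP !gP cutD cutZ.
pose rhoL := GRing.isLinear.Build _ _ _ _ _ rho_lin.
pose rho : {linear C -> quot I} := HB.pack (fun x => qpi I (g x)) rhoL.
have vv : qpi I (star (T aone) ** T aone) = aone.
  by rewrite -qpi1; apply/qpi_cutP; rewrite -pij j1 pi1 cut1.
exists I, (qpi I (T aone)), rho; split.
- by split; rewrite -qpi_star -qpiM 1?[T aone ** _]BC.
- split=> [x y|x].
    by rewrite -[RHS]qpiM; apply: rhoE; rewrite piM !gP cutM.
  by rewrite -[RHS]qpi_star; apply: rhoE; rewrite piS gP cut_star.
- by rewrite -qpi1; apply: rhoE; rewrite pi1 cut1.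
- by move=> x y /qpi_cutP; rewrite -!gP => /pi_inj.
- move=> a; rewrite -[rho _]/(qpi I (g (j a))) (rhoE _ _ (pij a)) -qpiM.
  by rewrite amulA [T aone ** star _]BC qpiM vv amul1x.
Qed.
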